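(* Let $\Lambda$ be a commutative Noetherian ring in which linear equations are solvable, $I=\langle\nu_1,\ldots,\nu_s\rangle$ a proper ideal of $\Lambda$, $R=\Lambda/I$, $T=\Lambda[x_1,\ldots,x_n]$, $A=R[x_1,\ldots,x_n]$, with a fixed monomial ordering $\prec$. Let $\overline J=\langle\overline f_1,\ldots,\overline f_t\rangle$ be an ideal of $A$, where $\overline f_i=\sum_j\overline\lambda_{ij}x^{\alpha(j)}\ne 0$ is written with nonzero coefficients $\overline\lambda_{ij}=\lambda_{ij}+I$, let $f_i=\sum_j\lambda_{ij}x^{\alpha(j)}\in T$, $S=\{f_1,\ldots,f_t,\nu_1,\ldots,\nu_s\}$, $J=\langle S\rangle\subseteq T$, and let $\mathcal G=\{g_1,\ldots,g_m\}$ be a Gröbner basis of $J$ with respect to $\prec$ constructed by the Gröbner basis algorithm (recalled in the context) with initial input $S$. Let $0\neq\overline f=\sum_i\overline\lambda_ix^{\alpha(i)}\in A$ with all $\overline\lambda_i\neq0$, $\overline\lambda_i=\lambda_i+I$. Then $\overline f\in\overline J$ if and only if $f=\sum_i\lambda_ix^{\alpha(i)}\in J$, if and only if $f$ reduces to $0$ modulo $\mathcal G$, i.e. by division by $\mathcal G$, $f$ has a Gröbner representation $$f=\sum_{i=1}^mh_ig_i,\quad h_i\in T,\ g_i\in\mathcal G,\qquad \mathbf{LM}(h_i)\mathbf{LM}(g_i)\preceq\mathbf{LM}(f)\ \text{for all } h_i\neq0.$$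
   Context: Linear equations are solvable in $\Lambda$ if there are algorithms (1) deciding, for $\lambda,\lambda_1,\ldots,\lambda_m\in\Lambda$, whether $\lambda\in\langle\lambda_1,\ldots,\lambda_m\rangle$ and in that case computing $\mu_i$ with $\lambda=\sum\lambda_i\mu_i$, and (2) computing generators of the syzygy module $\{(\mu_i)\in\Lambda^m\mid\sum\lambda_i\mu_i=0\}$. For a nonzero polynomial $f$ written with nonzero coefficients, $\mathbf{LM}(f)$ is its $\prec$-largest monomial, $\mathbf{LC}(f)$ the coefficient of $\mathbf{LM}(f)$, $\mathbf{LT}(f)=\mathbf{LC}(f)\mathbf{LM}(f)$. A finite set $\mathcal G$ of nonzero elements of an ideal $J$ is a Gröbner basis of $J$ if $\langle\mathbf{LT}(J)\rangle=\langle\mathbf{LT}(\mathcal G)\rangle$. Reduction: $f\ne0$ reduces in one step modulo a finite set $F$ of nonzero polynomials to $f-\sum_j\lambda_jx^{\alpha(j)}f_{i_j}$ if $f_{i_j}\in F$, $\lambda_j\in\Lambda-\{0\}$, $\mathbf{LM}(f)=x^{\alpha(j)}\mathbf{LM}(f_{i_j})$ for all $j$, and $\mathbf{LT}(f)=\sum_j\lambda_jx^{\alpha(j)}\mathbf{LT}(f_{i_j})$; $f\ne 0$ is minimal with respect to $F$ if no such step exists; ''$f$ reduces to $0$ modulo $F$'' means that a finite chain of such steps leads to $0$. Gröbner basis algorithm with input a finite set $S$ of nonzero polynomials (zero elements discarded): start with $G:=\emptyset$, $G':=S$. While $G'\ne G$: set $G:=G'=\{g_1,\ldots,g_k\}$;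 compute a finite homogeneous generating set $B$ of $\mathrm{Syz}_T(\mathbf{LT}(g_1),\ldots,\mathbf{LT}(g_k))$; for each $(h_1,\ldots,h_k)\in B$ reduce $\sum h_ig_i$ modulo the current $G'$ to some $r$ that is $0$ or minimal with respect to $G'$, and if $r\neq0$ replace $G'$ by $G'\cup\{r\}$. The output is $G$, a Gröbner basis of $\langle S\rangle$. *)

(* Defs.v *)
From HB Require Import structures.
From Stdlib Require Import Relations.
From mathcomp Require Import all_boot all_order all_algebra.
From mathcomp Require Import finmap mpoly.

Set Implicit Arguments.
Unset Strict Implicit.
Unset Printing Implicit Defensive.

Import GRing.Theory.
Local Open Scope ring_scope.
Local Open Scope quotient_scope.

Definition ideal_span (R : comNzRingType) (P : R -> Prop) (x : R) : Prop :=
  exists (k : nat) (c g : 'I_k -> R),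
    (forall i, P (g i)) /\ x = \sum_(i < k) c i * g i.

Definition is_ideal (R : comNzRingType) (J : R -> Prop) : Prop :=
  [/\ J 0, (forall x y, J x -> J y -> J (x + y))
    & (forall a x, J x -> J (a * x))].

Definition noetherian (R : comNzRingType) : Prop :=
  forall J : R -> Prop, is_ideal J ->
    exists F : seq R, forall x, J x <-> ideal_span (fun y => y \in F) x.

Definition syzygy (R : comNzRingType) (I : finType) (v h : I -> R) : Prop :=
  \sum_i v i * h i = 0.

Definition generates_syzygies (R : comNzRingType) (I : finType) (v : I -> R)
    (B : seq {ffun I -> R}) : Prop :=
  (forall h, h \in B -> syzygy v h) /\
  (forall h : I -> R, syzygy v h ->
     exists c : 'I_(size B) -> R,
       forall i, h i = \sum_(j < size B) c j * (B`_j : {ffun I -> R}) i).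

(* The algorithms are given as functions: [solve] answers [None] exactly on
   the elements outside the ideal generated by [v]. *)
Record linear_equations_solvable (R : comNzRingType) : Type := LinearSolver {
  solve : forall m : nat, ('I_m -> R) -> R -> option ('I_m -> R);
  syzygies : forall m : nat, ('I_m -> R) -> seq {ffun 'I_m -> R};
  solveP : forall m (v : 'I_m -> R) x,
    if solve v x is Some mu then x = \sum_(i < m) v i * mu i
    else ~ ideal_span (fun y => exists i, y = v i) x;
  syzygiesP : forall m (v : 'I_m -> R), generates_syzygies v (syzygies v)
}.

Record monomial_order (n : nat) : Type := MonomialOrder {
  mo_le :> rel 'X_{1..n};
  mo_total : total mo_le;
  mo_anti : antisymmetric mo_le;
  mo_trans : transitive mo_le;
  mo_add : forall m m1 m2, mo_le m1 m2 -> mo_le (m + m1)%MM (m + m2)%MM;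
  mo_wf : well_founded (fun m1 m2 => (m1 != m2) && mo_le m1 m2)
}.

(* Meaningful for [f != 0] only; [LM o 0] is the junk value [0%MM]. *)
Definition LM (n : nat) (o : monomial_order n) (L : comNzRingType)
    (f : {mpoly L[n]}) : 'X_{1..n} :=
  last 0%MM (sort o (msupp f)).

Definition LC (n : nat) (o : monomial_order n) (L : comNzRingType)
    (f : {mpoly L[n]}) : L :=
  f@_(LM o f).

Definition LT (n : nat) (o : monomial_order n) (L : comNzRingType)
    (f : {mpoly L[n]}) : {mpoly L[n]} :=
  LC o f *: 'X_[LM o f].

Definition groebner_basis (n : nat) (o : monomial_order n) (L : comNzRingType)
    (J : {mpoly L[n]} -> Prop) (G : {fset {mpoly L[n]}}) : Prop :=
  (forall g, g \in G -> g != 0 /\ J g) /\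
  (forall p, ideal_span (fun q => exists f, [/\ J f, f != 0 & q = LT o f]) p
         <-> ideal_span (fun q => exists g, g \in G /\ q = LT o g) p).

Definition reduction_step (n : nat) (o : monomial_order n) (L : comNzRingType)
    (F : {fset {mpoly L[n]}}) (f f' : {mpoly L[n]}) : Prop :=
  f != 0 /\
  exists (k : nat) (lam : 'I_k -> L) (a : 'I_k -> 'X_{1..n})
         (g : 'I_k -> {mpoly L[n]}),
    [/\ forall j, g j \in F /\ lam j != 0,
        forall j, LM o f = (a j + LM o (g j))%MM,
        LT o f = \sum_(j < k) lam j *: 'X_[a j] * LT o (g j)
      & f' = f - \sum_(j < k) lam j *: 'X_[a j] * g j].

Definition reduces (n : nat) (o : monomial_order n) (L : comNzRingType)
    (F : {fset {mpoly L[n]}}) : {mpoly L[n]} -> {mpoly L[n]} -> Prop :=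
  clos_refl_trans_1n _ (reduction_step o F).

Definition minimal (n : nat) (o : monomial_order n) (L : comNzRingType)
    (F : {fset {mpoly L[n]}}) (f : {mpoly L[n]}) : Prop :=
  f != 0 /\ ~ exists f', reduction_step o F f f'.

(* A tuple indexed by [G] is homogeneous of degree [m] when each nonzero entry
   [h g] is a term with [LM (h g) LM g = m]. *)
Definition homogeneous (n : nat) (o : monomial_order n) (L : comNzRingType)
    (G : {fset {mpoly L[n]}}) (h : {ffun G -> {mpoly L[n]}}) : Prop :=
  exists m : 'X_{1..n}, forall g : G, h g != 0 ->
    exists (c : L) (a : 'X_{1..n}),
      h g = c *: 'X_[a] /\ (a + LM o (val g))%MM = m.

Definition homogeneous_syzygy_basis (n : nat) (o : monomial_order n)
    (L : comNzRingType) (G : {fset {mpoly L[n]}})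
    (B : seq {ffun G -> {mpoly L[n]}}) : Prop :=
  [/\ uniq B, (forall h, h \in B -> homogeneous o h)
    & generates_syzygies (fun g : G => LT o (val g)) B].

(* [syzygy_pass o B G1 G2]: the inner loop over [B], entered with [G' = G1],
   can end with [G' = G2].  Reduction results are not unique, so this is a
   relation. *)
Inductive syzygy_pass (n : nat) (o : monomial_order n) (L : comNzRingType)
    (G : {fset {mpoly L[n]}}) :
    seq {ffun G -> {mpoly L[n]}} ->
    {fset {mpoly L[n]}} -> {fset {mpoly L[n]}} -> Prop :=
| syzygy_pass_nil (G1 : {fset {mpoly L[n]}}) : syzygy_pass o [::] G1 G1
| syzygy_pass_cons (h : {ffun G -> {mpoly L[n]}}) B r G1 G2 :
    reduces o G1 (\sum_(g : G) h g * val g) r ->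
    r = 0 \/ minimal o G1 r ->
    syzygy_pass o B (if r == 0 then G1 else (r |` G1)%fset) G2 ->
    syzygy_pass o (h :: B) G1 G2.

(* [groebner_loop o G G' out]: the outer loop, in state [(G, G')], can
   terminate with output [out]. *)
Inductive groebner_loop (n : nat) (o : monomial_order n) (L : comNzRingType) :
    {fset {mpoly L[n]}} -> {fset {mpoly L[n]}} -> {fset {mpoly L[n]}} -> Prop :=
| groebner_loop_stop G : groebner_loop o G G G
| groebner_loop_step (G G1 : {fset {mpoly L[n]}})
    (B : seq {ffun G1 -> {mpoly L[n]}}) (G2 out : {fset {mpoly L[n]}}) :
    G1 != G ->
    homogeneous_syzygy_basis o B ->
    syzygy_pass o B G1 G2 ->
    groebner_loop o G1 G2 out ->
    groebner_loop o G G1 out.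

Definition groebner_algorithm (n : nat) (o : monomial_order n)
    (L : comNzRingType) (S : seq {mpoly L[n]}) (out : {fset {mpoly L[n]}}) :
    Prop :=
  groebner_loop o fset0 [fset p in S | p != 0]%fset out.

(* [f] is obtained from [fbar], written with its nonzero coefficients, by
   replacing each coefficient by a representative; monomials outside the
   support of [fbar] get coefficient 0. *)
Definition coef_lift (L : comNzRingType) (I : idealr L) (n : nat)
    (fbar : {mpoly {ideal_quot I}[n]}) (f : {mpoly L[n]}) : Prop :=
  exists lam : 'X_{1..n} -> L,
    (forall m, m \in msupp fbar -> \pi_{ideal_quot I} (lam m) = fbar@_m) /\
    f = \sum_(m <- msupp fbar) lam m *: 'X_[m].

Definition groebner_representation (n : nat) (o : monomial_order n)
    (L : comNzRingType) (G : {fset {mpoly L[n]}}) (f : {mpoly L[n]}) : Prop :=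
  exists h : {ffun G -> {mpoly L[n]}},
    f = \sum_(g : G) h g * val g /\
    (forall g : G, h g != 0 -> o (LM o (h g) + LM o (val g))%MM (LM o f)).

(* Main.v *)
Require Import Defs.
From Stdlib Require Import Relation_Operators.
From mathcomp Require Import all_boot all_order all_algebra.
From mathcomp Require Import finmap mpoly.

Set Implicit Arguments.
Unset Strict Implicit.
Unset Printing Implicit Defensive.

Import GRing.Theory.
Local Open Scope ring_scope.

(** Reduction of coefficients [T -> A] is surjective and its kernel is generated
    by the [nu_i], all of which lie in [J]; hence [J] is the full preimage of
    [Jbar].  If [0 != f] lies in [J], then [LT f] lies in the ideal generated by
    the [LT g], so [f] admits a reduction step, which stays in [J] and lowers the
    leading monomial; well-foundedness of the order gives termination at [0]. *)

(** * Ideals and their generating sets *)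

Lemma ideal_span_ideal (R : comNzRingType) (P : R -> Prop) :
  is_ideal (ideal_span P).
Proof.
split=> [|x y [k [c [g [Pg ->]]]] [l [d [e [Pe ->]]]]|a x [k [c [g [Pg ->]]]]].
- by exists 0%N, (fun=> 0), (fun=> 0); split; [case|rewrite big_ord0].
- exists (k + l)%N, (fun i => match split i with inl u => c u | inr v => d v end),
    (fun i => match split i with inl u => g u | inr v => e v end); split.
    by move=> i; case: (split i).
  rewrite big_split_ord /=; congr (_ + _); apply: eq_bigr => i _.
    by rewrite (unsplitK (inl i)).
  by rewrite (unsplitK (inr i)).
- exists k, (fun i => a * c i), g; split=> //.
  by rewrite mulr_sumr; apply: eq_bigr => i _; rewrite mulrA.
Qed.

Lemma mem_ideal_span (R : comNzRingType) (P : R -> Prop) x :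
  P x -> ideal_span P x.
Proof.
by move=> Px; exists 1%N, (fun=> 1), (fun=> x); rewrite big_ord1 mul1r.
Qed.

Lemma ideal_sum (R : comNzRingType) (J : R -> Prop) (I : Type) (r : seq I)
    (P : pred I) (F : I -> R) :
  is_ideal J -> (forall i, P i -> J (F i)) -> J (\sum_(i <- r | P i) F i).
Proof. by case=> J0 JD _ JF; apply: big_ind. Qed.

Lemma ideal_sub (R : comNzRingType) (J : R -> Prop) x y :
  is_ideal J -> J x -> J y -> J (x - y).
Proof. by case=> _ JD JM Jx Jy; rewrite -mulN1r; apply: JD => //; apply: JM. Qed.

Lemma ideal_span_min (R : comNzRingType) (P J : R -> Prop) :
  is_ideal J -> (forall x, P x -> J x) -> forall x, ideal_span P x -> J x.
Proof.
move=> idJ PJ x [k [c [g [Pg ->]]]]; apply: ideal_sum => // i _.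
by case: idJ => _ _; apply; apply: PJ.
Qed.

(** * Transfer of ideals along a change of coefficients *)

Lemma map_mpoly_surjective (L R : comNzRingType) (phi : {rmorphism L -> R}) n :
  (forall y, exists x, phi x = y) ->
  forall q : {mpoly R[n]}, exists p, map_mpoly phi p = q.
Proof.
move=> surj q; rewrite [q]mpolyE.
apply: (big_ind (fun q => exists p, map_mpoly phi p = q)) =>
  [|_ _ [p1 <-] [p2 <-]|m _].
- by exists 0; rewrite raddf0.
- by exists (p1 + p2); rewrite raddfD.
have [c cE] := surj q@_m.
by exists (c *: 'X_[m]); rewrite map_mpolyZ map_mpolyX cE.
Qed.

(** A polynomial killed by [map_mpoly phi] has all its coefficients in the kernel of [phi], hence is
    a combination of the constants from [nu]. So lifting a combination of images costs only an error
    inside the ideal. *)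
Lemma ideal_span_map_mpoly (L R : comNzRingType) (phi : {rmorphism L -> R})
    (n : nat) (nu : seq L) (fs : seq {mpoly L[n]}) f :
  (forall y, exists x, phi x = y) ->
  (forall x, phi x = 0 <-> ideal_span (fun y => y \in nu) x) ->
  ideal_span (fun p => p \in map (map_mpoly phi) fs) (map_mpoly phi f) <->
  ideal_span (fun p => p \in fs ++ [seq c%:MP_[n] | c <- nu]) f.
Proof.
move=> surj ker_phi.
set J := ideal_span (fun p => p \in _ ++ _).
have idJ : is_ideal J by apply: ideal_span_ideal.
have [_ JD JM] := idJ.
have Jnu c : phi c = 0 -> J c%:MP.
  move=> /ker_phi [k [d [e [nue ->]]]]; rewrite raddf_sum.
  apply: ideal_sum => // i _; rewrite /= mpolyCM; apply: JM.
  by apply: mem_ideal_span; rewrite mem_cat map_f ?orbT.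
have Jker g : map_mpoly phi g = 0 -> J g.
  move=> g0; rewrite [g]mpolyE.
  apply: ideal_sum => // m _; rewrite -mul_mpolyC mulrC; apply/JM/Jnu.
  by rewrite -mcoeff_map_mpoly g0 mcoeff0.
split=> [[k [c [g [hg eqf]]]]|].
  have /fin_all_exists[d dE] i := map_mpoly_surjective surj (c i).
  have /fin_all_exists[e eE] i : exists e, e \in fs /\ map_mpoly phi e = g i.
    by have /mapP[e] := hg i; exists e.
  (* The lifted combination lies in [J] and differs from [f] by an element of the kernel. *)
  rewrite -(subrK (\sum_i d i * e i) f); apply: JD.
    apply: Jker; rewrite raddfB (raddf_sum (map_mpoly phi)) /= eqf; apply/eqP.
    rewrite subr_eq0; apply/eqP/eq_bigr => i _.
    by rewrite rmorphM /= dE (eE i).2.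
  apply: ideal_sum => // i _; apply/JM/mem_ideal_span.
  by rewrite mem_cat (eE i).1.
have [s0 sD sM] := ideal_span_ideal (fun p => p \in map (map_mpoly phi) fs).
(* The preimage of an ideal is an ideal, so only generators need checking; those coming from [nu]
   map to 0. *)
apply: (ideal_span_min (J := fun p => ideal_span _ (map_mpoly phi p))).
  split=> [|p q Jp Jq|p q Jq]; first by rewrite raddf0.
    by rewrite raddfD; apply: sD.
  by rewrite rmorphM; apply: sM.
move=> p; rewrite mem_cat => /orP[fsp|/mapP[c nuc ->]].
  by apply: mem_ideal_span; rewrite map_f.
have /ker_phi phi_c : ideal_span (fun y => y \in nu) c by apply: mem_ideal_span.
by rewrite map_mpolyC /= phi_c mpolyC0.
Qed.

(** * Lifting from the quotient ring *)

Section CoefficientLift.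
Variables (L : comNzRingType) (I : idealr L) (n : nat).

Local Notation piI := (\pi_({ideal_quot I})%qT : {rmorphism L -> {ideal_quot I}}).

Lemma map_mpoly_coef_lift (fbar : {mpoly {ideal_quot I}[n]}) f :
  coef_lift fbar f -> map_mpoly piI f = fbar.
Proof.
case=> lam [lamE ->]; rewrite [RHS]mpolyE rmorph_sum /=.
rewrite big_seq [RHS]big_seq; apply: eq_bigr => m /lamE lam_m.
by rewrite map_mpolyZ map_mpolyX /= lam_m.
Qed.

Lemma coef_lift_ideal_span (nu : seq L) t
    (fbars : t.-tuple {mpoly {ideal_quot I}[n]}) (fs : t.-tuple {mpoly L[n]})
    fbar f :
  (forall x, x \in I <-> ideal_span (fun y => y \in nu) x) ->
  (forall i, coef_lift (tnth fbars i) (tnth fs i)) ->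
  coef_lift fbar f ->
  ideal_span (fun p => p \in fbars) fbar <->
  ideal_span (fun p => p \in fs ++ [seq c%:MP_[n] | c <- nu]) f.
Proof.
move=> hI hfs /map_mpoly_coef_lift <-.
have -> : fbars = [tuple of map (map_mpoly piI) fs].
  by apply: eq_from_tnth => i; rewrite tnth_map (map_mpoly_coef_lift (hfs i)).
apply: ideal_span_map_mpoly => [y|x]; first by exists (repr y); rewrite /= reprK.
(* Writing [x] as [x - 0] turns membership in [I] into equality of the classes of [x] and 0. *)
rewrite -hI -[x in x \in I]subr0 Quotient.idealrBE.
by rewrite (raddf0 piI); split=> [->|/eqP].
Qed.

End CoefficientLift.

(** * Leading monomials and bounds on supports *)

Section Groebner.
Variables (n : nat) (o : monomial_order n) (L : comNzRingType).
Implicit Types (f g p q : {mpoly L[n]}) (m M : 'X_{1..n}) (G : {fset {mpoly L[n]}}).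

Lemma mo_refl m : o m m.
Proof. by have := mo_total o m m; rewrite orbb. Qed.

Lemma LM_msupp f : f != 0 -> LM o f \in msupp f.
Proof.
rewrite -msupp_eq0 /LM -(mem_sort o) -size_eq0 -(size_sort o).
by case: (sort o _) => // m r _; rewrite /= mem_last.
Qed.

(** Transitivity makes a sorted list pairwise ordered, so its last entry dominates all the
    others. *)
Lemma LM_max f m : m \in msupp f -> o m (LM o f).
Proof.
rewrite /LM -(mem_sort o).
have := sort_sorted (mo_total o) (msupp f).
rewrite (sorted_pairwise (@mo_trans _ o)).
case/lastP: (sort o _) => [//|r x]; rewrite pairwise_rcons last_rcons.
case/andP=> /allP rx _; rewrite mem_rcons in_cons => /predU1P[->|/rx //].
exact: mo_refl.
Qed.

(** The case split is forced by the truncated difference [k - m], which is meaningful only when the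
    monomial [m] divides [k]. *)
Lemma mcoeffMX_if p m k :
  (p * 'X_[m])@_k = if (m <= k)%MM then p@_(k - m) else 0.
Proof.
case: ifP => [le_mk|/negP nle_mk].
  by rewrite -{1}(submK le_mk) addmC mcoeffMX.
apply/eqP; rewrite mcoeff_eq0 (perm_mem (msuppMX p m)).
by apply/mapP => -[m' _ kE]; apply: nle_mk; rewrite kE lem_addr.
Qed.

(** Bounding the whole support, not [LM o p], makes the condition vacuous at 0, where [LM] is a junk
    value, and stable under sums with cancellation. *)
Definition bounded_by M p := forall m, m \in msupp p -> o m M.

Lemma bounded_byD M p q :
  bounded_by M p -> bounded_by M q -> bounded_by M (p + q).
Proof.
by move=> bp bq m /msuppD_le; rewrite mem_cat => /orP[/bp|/bq].
Qed.

Lemma bounded_byN M p : bounded_by M p -> bounded_by M (- p).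
Proof. by move=> bp m; rewrite (perm_mem (msuppN p)) => /bp. Qed.

Lemma bounded_by_termM M (c : L) a p :
  o (a + LM o p)%MM M -> bounded_by M (c *: 'X_[a] * p).
Proof.
move=> le_M m; rewrite -scalerAl => /msuppZ_le.
rewrite mulrC (perm_mem (msuppMX p a)) => /mapP[m' /LM_max le_m' ->].
exact: (mo_trans (mo_add a le_m') le_M).
Qed.

Lemma bounded_by_sum M (I : Type) (r : seq I) (F : I -> {mpoly L[n]}) :
  (forall i, bounded_by M (F i)) -> bounded_by M (\sum_(i <- r) F i).
Proof.
move=> bF; apply: big_ind => //; first by move=> m; rewrite msupp0.
exact: bounded_byD.
Qed.

(** * Reduction steps and membership in the ideal *)

Lemma reduction_step_bounded G f f' :
  reduction_step o G f f' -> bounded_by (LM o f) f'.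
Proof.
case=> _ [k [lam [a [g [_ LMf _ ->]]]]].
apply: bounded_byD; first by move=> m /LM_max.
apply/bounded_byN/bounded_by_sum => j.
by apply: bounded_by_termM; rewrite -LMf mo_refl.
Qed.

(** The subtracted sum has the same coefficient as [f] at [LM o f], so this monomial leaves the
    support, while no larger one enters it. *)
Lemma reduction_step_LM G f f' :
  reduction_step o G f f' -> f' != 0 ->
  (LM o f' != LM o f) && o (LM o f') (LM o f).
Proof.
move=> step f'0; rewrite (reduction_step_bounded step (LM_msupp f'0)) andbT.
apply: contraTneq (LM_msupp f'0) => ->; rewrite -mcoeff_eq0.
case: step => _ [k [lam [a [g [_ LMf LTf ->]]]]].
rewrite mcoeffB subr_eq0; apply/eqP.
have {LTf} := congr1 (mcoeff (LM o f)) LTf.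
rewrite /LT mcoeffZ mcoeffX eqxx mulr1 /LC => ->.
(* At the monomial [a j + LM o (g j)], the multiples of [g j] and of [LT o (g j)] by ['X_[a j]] have
   the same coefficient. *)
rewrite !raddf_sum /=; apply: eq_bigr => j _.
rewrite -!scalerAl !mcoeffZ; congr (_ * _).
by rewrite mulrC [in RHS]mulrC (LMf j) !mcoeffMX mcoeffZ mcoeffX eqxx mulr1.
Qed.

Lemma reduction_step_sub_ideal (J : {mpoly L[n]} -> Prop) G f f' :
  is_ideal J -> (forall g, g \in G -> J g) -> reduction_step o G f f' ->
  J (f - f').
Proof.
move=> idJ GJ [_ [k [lam [a [g [Gg _ _ ->]]]]]].
rewrite opprB addrC subrK; apply: ideal_sum => // j _.
by case: idJ => _ _; apply; apply/GJ/(Gg j).1.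
Qed.

(* Comparing the coefficients of [LM f] in an expression of [LT f] through the
   [LT g] keeps only the terms whose monomial is exactly [LM f]. *)
Lemma groebner_basis_reducible (J : {mpoly L[n]} -> Prop) G f :
  groebner_basis o J G -> J f -> f != 0 -> exists f', reduction_step o G f f'.
Proof.
move=> [_ spanLT] Jf f0.
have /spanLT[k [c [p [LTp LTf]]]] :
    ideal_span (fun q => exists f, [/\ J f, f != 0 & q = LT o f]) (LT o f).
  by apply: mem_ideal_span; exists f.
have /fin_all_exists[g gE] := LTp.
pose lam i := (c i)@_(LM o f - LM o (g i)).
(* Divisibility gives sense to the truncated difference in [lam]; vanishing coefficients are dropped
   because a reduction step admits only nonzero ones. *)
pose A := [pred i | (LM o (g i) <= LM o f)%MM && (lam i != 0)].
have LCf : LC o f = \sum_(i in A) lam i * LC o (g i).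
  have := congr1 (mcoeff (LM o f)) LTf.
  rewrite /LT mcoeffZ mcoeffX eqxx mulr1 => ->.
  rewrite raddf_sum [RHS]big_mkcond /=; apply: eq_bigr => i _.
  rewrite (gE i).2 /LT -scalerAr mcoeffZ mcoeffMX_if inE mulrC -/(lam i).
  case: ifP => // _; last by rewrite mul0r.
  by case: eqP => //= ->; rewrite mul0r.
have AP (j : 'I_#|A|) : LM o f
    = (LM o f - LM o (g (enum_val j)) + LM o (g (enum_val j)))%MM.
  by rewrite submK //; have /andP[] := enum_valP j.
eexists; split=> //; exists #|A|, (fun j => lam (enum_val j)),
  (fun j => (LM o f - LM o (g (enum_val j)))%MM), (fun j => g (enum_val j)).
split=> // [j|].
  by split; [apply: (gE _).1|have /andP[] := enum_valP j].
rewrite {1}/LT LCf big_enum_val scaler_suml; apply: eq_bigr => j _.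
by rewrite {1}(AP j) mpolyXD /LT -scalerAl -scalerAr scalerA.
Qed.

(** For the converse, each step changes the polynomial by an element of [J], so membership passes
    back along the chain from 0. *)
Lemma groebner_basis_reduces (J : {mpoly L[n]} -> Prop) G f :
  is_ideal J -> groebner_basis o J G -> J f <-> reduces o G f 0.
Proof.
move=> idJ gbG; have GJ g : g \in G -> J g by case: gbG => + _ => /[apply] -[].
split=> [|red_f].
  move Em : (LM o f) => m; elim: (mo_wf o m) f Em => {}m _ IH f Em Jf.
  have [->|f0] := eqVneq f 0; first exact: rt1n_refl.
  have [f' step] := groebner_basis_reducible gbG Jf f0.
  apply: (rt1n_trans _ _ _ f') => //.
  (* The value 0 is treated apart, since the descent of [LM] holds only for nonzero results. *)
  have [->|f'0] := eqVneq f' 0; first exact: rt1n_refl.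
  apply: IH (erefl _) _; first by rewrite -Em; apply: reduction_step_LM step f'0.
  rewrite -(subKr f f'); apply: ideal_sub => //.
  exact: reduction_step_sub_ideal step.
move: red_f; rewrite /reduces; move Ez: 0 => z red_f.
elim: red_f Ez => [_ <-|p q r step _ IH /IH Jq].
  by case: idJ.
rewrite -(subrK q p); case: (idJ) => _ JD _; apply: JD => //.
exact: reduction_step_sub_ideal step.
Qed.

(** * From reduction chains to Gröbner representations *)

(** The bound [M] is independent of [f], so representations with a common bound can be added even
    when leading terms cancel. *)
Definition bounded_representation G M f :=
  exists h : {ffun G -> {mpoly L[n]}}, f = \sum_(g : G) h g * val g /\
    forall g : G, forall m, m \in msupp (h g) -> o (m + LM o (val g))%MM M.

Lemma bounded_representation0 G M : bounded_representation G M 0.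
Proof.
exists [ffun=> 0]; split=> [|g m]; last by rewrite ffunE msupp0.
by rewrite big1 // => g _; rewrite ffunE mul0r.
Qed.

Lemma bounded_representationD G M p q :
  bounded_representation G M p -> bounded_representation G M q ->
  bounded_representation G M (p + q).
Proof.
move=> [h [-> hM]] [k [-> kM]]; exists [ffun g => h g + k g]; split.
  by rewrite -big_split; apply: eq_bigr => g _; rewrite ffunE mulrDl.
by move=> g m; rewrite ffunE => /msuppD_le; rewrite mem_cat => /orP[/hM|/kM].
Qed.

Lemma bounded_representation_term G M (c : L) a g :
  g \in G -> o (a + LM o g)%MM M ->
  bounded_representation G M (c *: 'X_[a] * g).
Proof.
move=> Gg le_M; pose g0 : G := [` Gg]%fset.
exists [ffun g' => if g' == g0 then c *: 'X_[a] else 0]; split.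
  rewrite (bigD1 g0) //= ffunE eqxx big1 ?addr0 // => g' /negPf ng'.
  by rewrite ffunE ng' mul0r.
move=> g' m; rewrite ffunE; case: eqP => [->|_]; last by rewrite msupp0.
by move=> /msuppZ_le; rewrite msuppX mem_seq1 => /eqP->.
Qed.

(** Leading monomials only decrease along the chain, so the multiples subtracted at every step obey
    the initial bound [M]; adding them all up represents [f]. *)
Lemma reduces0_bounded_representation G M f :
  reduces o G f 0 -> bounded_by M f -> bounded_representation G M f.
Proof.
rewrite /reduces; move Ez: 0 => z red_f.
elim: red_f Ez => {f} [z' <- _|f f' r step _ IH Er bf].
  exact: bounded_representation0.
have f0 : f != 0 by case: step.
have le_M : o (LM o f) M by apply/bf/LM_msupp.
have {}IH : bounded_representation G M f'.
  apply: IH => // m /(reduction_step_bounded step) le_m.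
  exact: (mo_trans le_m le_M).
case: step IH => _ [k [lam [a [g [Gg LMf _ ->]]]]] IH.
rewrite -(subrK (\sum_(j < k) lam j *: 'X_[a j] * g j) f).
apply: bounded_representationD => //; apply: big_ind => [||j _].
- exact: bounded_representation0.
- exact: bounded_representationD.
by apply: bounded_representation_term; [apply: (Gg j).1|rewrite -LMf].
Qed.

Lemma reduces0_groebner_representation G f :
  reduces o G f 0 -> groebner_representation o G f.
Proof.
(* The chain is read with the sharpest bound, [M] equal to [LM o f]. *)
move=> /reduces0_bounded_representation /(_ (@LM_max f))[h [fE hM]].
by exists h; split=> // g /LM_msupp /hM.
Qed.

Lemma groebner_representation_ideal (J : {mpoly L[n]} -> Prop) G f :
  is_ideal J -> (forall g, g \in G -> J g) ->
  groebner_representation o G f -> J f.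
Proof.
move=> idJ GJ [h [-> _]]; apply: ideal_sum => // g _.
by case: idJ => _ _; apply; apply/GJ/fsvalP.
Qed.

End Groebner.

Theorem proposition2p4
  (L : comNzRingType)
  (hNoeth : noetherian L)
  (hsolv : linear_equations_solvable L)
  (I : idealr L)
  (s : nat) (nu : s.-tuple L)
  (hI : forall x : L, x \in I <-> ideal_span (fun y => y \in nu) x)
  (n : nat) (o : monomial_order n)
  (t : nat)
  (fbars : t.-tuple {mpoly {ideal_quot I}[n]})
  (hfbars : forall i, tnth fbars i != 0)
  (fs : t.-tuple {mpoly L[n]})
  (hfs : forall i, coef_lift (tnth fbars i) (tnth fs i))
  (S : seq {mpoly L[n]})
  (hS : S = fs ++ [seq c%:MP_[n] | c <- nu])
  (J : {mpoly L[n]} -> Prop)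
  (hJ : J = ideal_span (fun p => p \in S))
  (Jbar : {mpoly {ideal_quot I}[n]} -> Prop)
  (hJbar : Jbar = ideal_span (fun p => p \in fbars))
  (G : {fset {mpoly L[n]}})
  (hGalg : groebner_algorithm o S G)
  (hG : groebner_basis o J G)
  (fbar : {mpoly {ideal_quot I}[n]})
  (hfbar : fbar != 0)
  (f : {mpoly L[n]})
  (hf : coef_lift fbar f) :
  [/\ Jbar fbar <-> J f,
      J f <-> reduces o G f 0
    & reduces o G f 0 <-> groebner_representation o G f].
Proof.
have idJ : is_ideal J by rewrite hJ; apply: ideal_span_ideal.
have J_reduces : J f <-> reduces o G f 0 by apply: groebner_basis_reduces.
split=> //; first by rewrite hJbar hJ hS; apply: coef_lift_ideal_span.
split; first exact: reduces0_groebner_representation.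
(* The way back from a representation to a reduction passes through membership in [J]. *)
move=> repf; apply/J_reduces; apply: groebner_representation_ideal repf => //.
by move=> g; case: hG => + _ => /[apply] -[].
Qed.
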